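(* Let $m\ge 3$, $n\ge 1$, let $A_1, \dots, A_m \in M_n(\mathbb{C})$ be positive semi-definite matrices, and let $r \in \{1,\dots,m-2\}\cup [m-1,\infty)$. Let $K=\{1,\dots,m\}$ and for each nonempty $J\subseteq K$ put $A_J=\sum_{j\in J}A_j$. Then for any generalized matrix function $d=d_\chi^G$ on $M_n(\mathbb{C})$, $$\sum_{j=1}^m(-1)^{m-j}\left(\sum_{J\subseteq K,\ |J|=j}d(A_J)^r\right)\ge 0.$$
   Context: $M_n(\mathbb{C})$ denotes the $n\times n$ complex matrices; positive semi-definite matrices are Hermitian. Let $G$ be a subgroup of the symmetric group $S_n$ and let $\chi$ be a linear (i.e. degree-one complex) character of $G$. The generalized matrix function associated with $G$ and $\chi$ is $d_\chi^G(A)=\sum_{\sigma\in G}\chi(\sigma)\prod_{i=1}^n a_{i\,\sigma(i)}$ for $A=(a_{ij})\in M_n(\mathbb{C})$. On positive semi-definite matrices its values are nonnegative real numbers, so real powers make sense. *)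

(* Defs.v *)
From HB Require Import structures.
From mathcomp Require Import all_boot all_order all_fingroup all_algebra.
From mathcomp Require Import mxrepresentation.
From mathcomp Require Import complex.
From mathcomp Require Import reals exp.

Set Implicit Arguments.
Unset Strict Implicit.
Unset Printing Implicit Defensive.

Import Order.TTheory GRing.Theory Num.Theory.
Local Open Scope ring_scope.
Local Open Scope complex_scope.
Local Open Scope sesquilinear_scope.

(* In the order of [R[i]], [0 <= z] says that [z] is a nonnegative real. *)
Definition psdmx (R : realType) (n : nat) (A : 'M[R[i]]_n) : Prop :=
  A \is hermsymmx /\
  forall x : 'cV[R[i]]_n, 0 <= (x ^t* *m A *m x) ord0 ord0.

(* [chi] is only constrained on [G]; its values outside [G] are never used.
   The characters of the library (character.v) take values in [algC], hence
   the direct definition over [R[i]] as the trace of a representation. *)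
Definition is_linear_char (R : realType) (n : nat) (G : {group 'S_n})
    (chi : 'S_n -> R[i]) : Prop :=
  exists rG : mx_representation R[i] G 1,
    forall s : 'S_n, s \in G -> chi s = \tr (rG s).

Definition gen_matrix_fun (R : realType) (n : nat) (G : {group 'S_n})
    (chi : 'S_n -> R[i]) (A : 'M[R[i]]_n) : R[i] :=
  \sum_(s in G) chi s * \prod_(i < n) A i (s i).

(* Main.v *)
(* Polarization writes d(sum_k v_k A_k) as a polynomial in v with nonnegative
   coefficients: averaging over G turns the coefficient of the word p into
     sum_{t, u in G} conj(chi t) chi(u) prod_i (A_{p i})_{t i, u i},
   which the spectral theorem exhibits as a sum of squared moduli.  Hence all
   mixed forward differences of f(v) = d(sum_k v_k A_k) are nonnegative, and the
   alternating sum is the m-th mixed difference of f^r at 0.  Functions with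
   nonnegative mixed differences are closed under products, which settles
   integer r.  For real r >= m - 1 one inducts on the number of differences:
   (f + t Delta f)^r interpolates between f^r and its shift, and its derivative
   r (f + t Delta f)^(r-1) Delta f has nonnegative differences of one order
   less, so by the mean value theorem so has Delta(f^r). *)
Require Import Defs.
From HB Require Import structures.
From mathcomp Require Import boolp classical_sets functions topology.
From mathcomp Require Import normedtype derive realfun ring lra zify.
From mathcomp Require Import all_boot all_order all_fingroup all_algebra.
From mathcomp Require Import mxrepresentation.
From mathcomp Require Import complex.
From mathcomp Require Import reals exp.

Set Implicit Arguments.
Unset Strict Implicit.
Unset Printing Implicit Defensive.

Import Order.TTheory GRing.Theory Num.Theory.
Import numFieldNormedType.Exports.
Local Open Scope ring_scope.
Local Open Scope complex_scope.

(** * Mixed forward differences of real functions on a commutative monoid *)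

Section MixedDifferences.
Local Open Scope classical_set_scope.
Local Open Scope ring_scope.
Variables (R : realType) (V : nmodType).
Implicit Types (f g : V -> R) (h v : V) (s : seq V).

Definition fdiff h f v := f (v + h) - f v.

(* Every mixed difference of [f] along a subsequence of [s], of order zero
   included, is nonnegative everywhere. *)
Fixpoint diffs_ge0 s f : Prop :=
  if s is h :: s' then diffs_ge0 s' f /\ diffs_ge0 s' (fdiff h f)
  else forall v, 0 <= f v.

Definition iter_fdiff s f := foldl (fun g h => fdiff h g) f s.

Lemma diffs_ge0_ext s f g : f =1 g -> diffs_ge0 s f -> diffs_ge0 s g.
Proof. by move=> fg; have -> : g = f by apply/funext => v; rewrite fg. Qed.

Lemma diffs_ge0_pointwise s f v : diffs_ge0 s f -> 0 <= f v.
Proof. by elim: s f => [|h s IH] f //= [/IH]. Qed.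

Lemma iter_fdiff_ge0 s f v : diffs_ge0 s f -> 0 <= iter_fdiff s f v.
Proof. by elim: s f => [|h s IH] f //= [_ /IH]. Qed.

Lemma diffs_ge0_cst s (c : R) : 0 <= c -> diffs_ge0 s (fun=> c).
Proof.
elim: s c => [|h s IH] c c0 //=; split; first exact: IH.
by apply: diffs_ge0_ext (IH 0 _) => // v; rewrite /fdiff subrr.
Qed.

Lemma diffs_ge0D s f g :
  diffs_ge0 s f -> diffs_ge0 s g -> diffs_ge0 s (fun v => f v + g v).
Proof.
elim: s f g => [|h s IH] f g /= => [f0 g0 v|[f0 f1] [g0 g1]].
  by rewrite addr_ge0.
split; first exact: IH.
by apply: diffs_ge0_ext (IH _ _ f1 g1) => v; rewrite /fdiff; ring.
Qed.

(** The discrete Leibniz rule [Delta(f g) = Delta f * g + f * Delta g + Delta f * Delta g] has only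
    plus signs. It brings back [f] and [g] undifferenced, so the lower orders must be nonnegative as
    well. *)
Lemma diffs_ge0M s f g :
  diffs_ge0 s f -> diffs_ge0 s g -> diffs_ge0 s (fun v => f v * g v).
Proof.
elim: s f g => [|h s IH] f g /= => [f0 g0 v|[f0 f1] [g0 g1]].
  by rewrite mulr_ge0.
split; first exact: IH.
apply: diffs_ge0_ext (diffs_ge0D (IH _ _ f1 g0)
  (diffs_ge0D (IH _ _ f0 g1) (IH _ _ f1 g1))) => v.
by rewrite /fdiff; ring.
Qed.

Lemma diffs_ge0_sum (I : Type) (r : seq I) s (F : I -> V -> R) :
  (forall i, diffs_ge0 s (F i)) -> diffs_ge0 s (fun v => \sum_(i <- r) F i v).
Proof.
move=> F0; elim: r => [|i r IH].
  by apply: diffs_ge0_ext (diffs_ge0_cst s (lexx 0)) => v; rewrite big_nil.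
by apply: diffs_ge0_ext (diffs_ge0D (F0 i) IH) => v; rewrite big_cons.
Qed.

Lemma diffs_ge0_prod (I : Type) (r : seq I) s (F : I -> V -> R) :
  (forall i, diffs_ge0 s (F i)) -> diffs_ge0 s (fun v => \prod_(i <- r) F i v).
Proof.
move=> F0; elim: r => [|i r IH].
  by apply: diffs_ge0_ext (diffs_ge0_cst s ler01) => v; rewrite big_nil.
by apply: diffs_ge0_ext (diffs_ge0M (F0 i) IH) => v; rewrite big_cons.
Qed.

Lemma diffs_ge0X s f n : diffs_ge0 s f -> diffs_ge0 s (fun v => f v ^+ n).
Proof.
move=> f0; elim: n => [|n IH].
  exact: diffs_ge0_ext (diffs_ge0_cst s ler01).
by apply: diffs_ge0_ext (diffs_ge0M f0 IH) => v; rewrite exprS.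
Qed.

(** Differences in [v] commute with the derivative in [t], so [H] and [dH] are differenced together
    until [s] is exhausted; the mean value theorem then applies at each point. *)
Lemma diffs_ge0_increment s (H dH : R -> V -> R) :
  (forall v, {within `[0, 1]%classic, continuous (H ^~ v)}) ->
  (forall v (t : R), t \in `]0, 1[ -> is_derive t 1 (H ^~ v) (dH t v)) ->
  (forall t : R, t \in `]0, 1[ -> diffs_ge0 s (dH t)) ->
  diffs_ge0 s (fun v => H 1 v - H 0 v).
Proof.
elim: s H dH => [|h s IH] H dH cH derH dH0 /=.
  move=> v; have [c c01] := MVT ltr01 (derH v) (cH v).
  by rewrite subr0 mulr1 => ->; exact: dH0.
split; first by apply: (IH H dH) => // t /dH0[].
apply: (@diffs_ge0_ext _ (fun v => fdiff h (H 1) v - fdiff h (H 0) v)).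
  by move=> v; rewrite /fdiff; ring.
apply: (IH (fun t => fdiff h (H t)) (fun t => fdiff h (dH t))).
- by move=> v x; apply: continuousB; exact: cH.
- by move=> v t t01; apply: is_deriveB; exact: derH.
- by move=> t /dH0[].
Qed.

(* At [a = b = 0] the base stays at the singularity of [powR], but is constant. *)
Lemma is_derive_powR_affine (a b r t : R) : 0 <= a -> 0 <= b -> 0 < t ->
  is_derive t 1 (fun u => powR (a + u * b) r) (r * powR (a + t * b) (r - 1) * b).
Proof.
move=> a0 b0 t0; have [ab0|] := ltP 0 (a + t * b).
  have dab : is_derive t 1 (fun u : R => a + u * b) b.
    have -> : (fun u : R => a + u * b) = cst a + (fun u => u * b) by [].
    apply: is_derive_eq; rewrite add0r; rewrite /GRing.scale /=; ring.
  have := @is_derive1_comp _ (fun x => powR x r) (fun u => a + u * b) t _ _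
    (is_derive1_powR r ab0) dab.
  exact.
move=> ab0; have tb0 : 0 <= t * b by rewrite mulr_ge0 // ltW.
have b00 : b = 0.
  apply/eqP; have : t * b = 0 by apply/eqP; lra.
  by move/eqP; rewrite mulf_eq0 gt_eqF.
rewrite b00 mulr0.
have -> : (fun u : R => powR (a + u * 0) r) = cst (powR a r).
  by apply/funext => u; rewrite mulr0 addr0.
exact: is_derive_cst.
Qed.

Lemma continuous_powR_affine (a b r : R) : 0 <= a -> 0 <= b -> 0 < r ->
  {within `[0, 1]%classic, continuous (fun u : R => powR (a + u * b) r)}.
Proof.
move=> a0 b0 r0.
have cpos (t : R) : 0 < t -> {for t, continuous (fun u : R => powR (a + u * b) r)}.
  move=> t0; apply: differentiable_continuous; apply/derivable1_diffP.
  exact: (ex_derive (is_derive := is_derive_powR_affine r a0 b0 t0)).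
apply/(continuous_within_itvP _ ltr01); split.
- by move=> t; rewrite in_itv/= => /andP[t0 _]; exact: cpos.
(* At the left endpoint with [a = 0] the power is taken at its singularity; there [(u b)^r] factors
   as [u^r b^r], and [u^r] tends to 0 because [r > 0]. *)
- move: a0; rewrite le_eqVlt => /predU1P[<-|a0].
    rewrite mul0r addr0 powR0 ?gt_eqF//.
    have cvg0 : powR u r * powR b r @[u --> 0^'+] --> (0 : R).
      rewrite -[X in _ --> X](mul0r (powR b r)).
      by apply: cvgMr_tmp; exact: powR_cvg0.
    apply: cvg_trans cvg0; apply: near_eq_cvg; near=> u.
    by rewrite add0r powRM // ltW //; near: u; exact: nbhs_right_gt.
  apply: cvg_at_right_filter.
  apply: (@continuous_comp _ _ _ (fun u : R => a + u * b) (fun x => powR x r)).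
    by apply: cvgD; [exact: cvg_cst|apply: cvgMr_tmp; exact: cvg_id].
  rewrite mul0r addr0.
  apply: differentiable_continuous; apply/derivable1_diffP.
  exact: (ex_derive (is_derive := is_derive1_powR r a0)).
- by apply: cvg_at_left_filter; exact: cpos.
Unshelve. all: by end_near. Qed.

Lemma diffs_ge0_powR s f (r : R) : 0 <= r -> (size s)%:R <= r + 1 ->
  diffs_ge0 s f -> diffs_ge0 s (fun v => powR (f v) r).
Proof.
elim: s r f => [|h s IH] r f r0 sr /=; first by move=> _ v; exact: powR_ge0.
move=> [f0 f1]; move: sr; rewrite /= -natr1 lerD2r => sr.
split; first by apply: IH => //; lra.
have f0v v := diffs_ge0_pointwise v f0.
have f1v v := diffs_ge0_pointwise v f1.
(* A single difference only needs monotonicity of the power. It is treated apart because [r] may be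
   below 1, and the induction hypothesis at [r - 1] requires a nonnegative exponent. *)
have [s0|s0] := posnP (size s).
  rewrite (size0nil s0) => v; rewrite subr_ge0.
  by apply: ge0_ler_powR; rewrite ?nnegrE// -subr_ge0; exact: f1v.
have r1 : 1 <= r by apply: le_trans sr; rewrite ler1n.
pose H t v := powR (f v + t * fdiff h f v) r.
apply: (@diffs_ge0_ext _ (fun v => H 1 v - H 0 v)).
  by move=> v; rewrite /H /fdiff; congr (powR _ r - powR _ r); ring.
apply: (@diffs_ge0_increment _ _
  (fun t v => r * powR (f v + t * fdiff h f v) (r - 1) * fdiff h f v)).
- by move=> v; apply: continuous_powR_affine => //; lra.
- by move=> v t; rewrite in_itv/= => /andP[t0 _]; exact: is_derive_powR_affine.
- move=> t; rewrite in_itv/= => /andP[t0 _].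
  apply: diffs_ge0M => //; apply: diffs_ge0M; first exact: diffs_ge0_cst.
  apply: IH; [lra|lra|].
  by apply: diffs_ge0D => //; apply: diffs_ge0M => //; apply: diffs_ge0_cst; exact: ltW.
Qed.

(** Each difference either shifts the argument by [e x], with sign plus, or keeps it, with sign
    minus; [J] records the shifts taken. *)
Lemma iter_fdiff_subsets (T : finType) (e : T -> V) (s : seq T) f v : uniq s ->
  iter_fdiff [seq e k | k <- s] f v =
  \sum_(J : {set T} | J \subset s)
    (-1) ^+ (size s - #|J|) * f (v + \sum_(k in J) e k).
Proof.
elim: s f v => [|x s IH] f v /=.
  move=> _; rewrite (big_pred1 set0) => [|J].
    by rewrite cards0 expr0 mul1r big_set0 addr0.
  apply/subsetP/eqP => [J0|-> y]; last by rewrite inE.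
  by apply/setP => y; rewrite inE; apply/negbTE/negP => /J0.
move=> /andP[xs us]; rewrite IH //.
have notinJ (J : {set T}) : J \subset s -> x \notin J.
  by move=> Js; apply: contra xs; exact: (subsetP Js).
have consS (J : {set T}) : J \subset s -> {subset J <= x :: s}.
  by move=> /subsetP Js y /Js ys; rewrite inE ys orbT.
have unconsS (J : {set T}) :
    x \notin J -> {subset J <= x :: s} -> J \subset s.
  move=> xJ Js; apply/subsetP => y yJ; have := Js y yJ.
  by rewrite inE => /predU1P[yx|//]; rewrite -yx yJ in xJ.
(* Sets containing [x] match the shifted term of the difference through [J] to [x |: J]; the others
   match the unshifted term. *)
rewrite [RHS](bigID (fun J : {set T} => x \in J)) /=.
rewrite [X in X + _](reindex_onto (fun J => x |: J) (fun J => J :\ x)) /=; last first.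
  by move=> J /andP[_ xJ]; rewrite setD1K.
rewrite [X in X + _](eq_bigl (fun J : {set T} => J \subset s)); last first.
  move=> J; rewrite setU11 andbT.
  apply/andP/idP => [[/subsetP Js /eqP xJ]|Js].
    have xnJ : x \notin J by rewrite -xJ setD11.
    by apply: unconsS => // y yJ; apply: Js; rewrite setU1r.
  split; last by rewrite setU1K ?notinJ.
  by apply/subsetP => y /setU1P[->|/(consS _ Js)//]; exact: mem_head.
rewrite [X in _ + X](eq_bigl (fun J : {set T} => J \subset s)); last first.
  move=> J; apply/andP/idP => [[/subsetP Js xJ]|Js]; first exact: unconsS.
  by split; [exact/subsetP/consS|exact: notinJ].
rewrite -big_split /=; apply: eq_bigr => J Js.
have cardJ : (#|J| <= size s)%N.
  exact: leq_trans (subset_leq_card Js) (card_size s).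
rewrite cardsU1 notinJ // add1n subSS big_setU1 ?notinJ //= subSn // exprS.
by rewrite /fdiff addrAC -addrA; ring.
Qed.

End MixedDifferences.

(** The increment of a coordinate is the constant [h k], nonnegative because steps are vectors of
    natural numbers. *)
Lemma diffs_ge0_eval (R : realType) (T : finType) (s : seq {ffun T -> nat}) (k : T) :
  diffs_ge0 s (fun v : {ffun T -> nat} => (v k)%:R : R).
Proof.
elim: s => [|h s IH] //=; split => //.
apply: diffs_ge0_ext (diffs_ge0_cst _ (ler0n R (h k))) => v.
by rewrite /fdiff ffunE natrD addrC addKr.
Qed.

(** * Spectral decomposition and positivity of the polarized double sum *)

Section HermitianForms.
Variables (C : numClosedFieldType) (n : nat).
Local Open Scope sesquilinear_scope.

Lemma psd_spectral_entries (A : 'M[C]_n) : A \is hermsymmx ->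
    (forall x : 'cV[C]_n, 0 <= (x ^t* *m A *m x) ord0 ord0) ->
  exists (P : 'M[C]_n) (d : 'I_n -> C), (forall l, 0 <= d l) /\
    forall i j, A i j = \sum_l d l * (Num.conj (P l i) * P l j).
Proof.
move=> /hermitian_normalmx /orthomx_spectralP; set P := spectralmx A.
have uP : P \is unitarymx by exact: spectral_unitarymx.
rewrite invmx_unitary // => eqA A0.
exists P, (fun l => spectral_diag A 0 l); split=> [l|i j].
  (* The quadratic form at the [l]-th column of [P ^t*], an eigenvector, equals the [l]-th
     eigenvalue. *)
  have := A0 (col l (P ^t*)).
  have -> : (col l (P ^t*)) ^t* = row l P.
    by apply/matrixP => a b; rewrite !mxE conjCK.
  have -> : (row l P *m A *m col l (P ^t*)) ord0 ord0 = (P *m A *m P ^t*) l l.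
    rewrite -row_mul mxE [RHS]mxE; apply: eq_bigr => k _.
    by rewrite [_ ord0 k]mxE [_ k ord0]mxE.
  rewrite [X in _ *m X *m _]eqA !mulmxA (unitarymxP uP) mul1mx.
  by rewrite -mulmxA (unitarymxP uP) mulmx1 mxE eqxx mulr1n.
rewrite [LHS](congr1 (fun M : 'M_n => M i j) eqA) mxE; apply: eq_bigr => l _.
by rewrite mul_mx_diag !mxE; ring.
Qed.

Lemma polarized_gmf_ge0 (G : {set 'S_n}) (chi : 'S_n -> C) (B : 'I_n -> 'M[C]_n) :
    (forall i, B i \is hermsymmx) ->
    (forall i (x : 'cV[C]_n), 0 <= (x ^t* *m B i *m x) ord0 ord0) ->
  0 <= \sum_(t in G) \sum_(u in G)
         Num.conj (chi t) * chi u * \prod_i B i (t i) (u i).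
Proof.
move=> Bh B0.
have /choice[P /choice[d Pd]] := fun i => psd_spectral_entries (Bh i) (B0 i).
(* [q] selects one eigenvalue index for each factor [B i]. For fixed [q] the dependence on [t] and
   [u] separates into [w q u] and the conjugate of [w q t]. *)
pose w (q : {ffun 'I_n -> 'I_n}) t := chi t * \prod_i P i (q i) (t i).
suff -> : \sum_(t in G) \sum_(u in G)
    Num.conj (chi t) * chi u * \prod_i B i (t i) (u i) =
    \sum_(q : {ffun 'I_n -> 'I_n}) (\prod_i d i (q i)) *
      (Num.conj (\sum_(t in G) w q t) * \sum_(u in G) w q u).
  apply: sumr_ge0 => q _; apply: mulr_ge0.
    by apply: prodr_ge0 => i _; have [] := Pd i.
  by rewrite mulrC mul_conjC_ge0.
transitivity (\sum_(t in G) \sum_(u in G)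
    \sum_(q : {ffun 'I_n -> 'I_n})
    (\prod_i d i (q i)) * (Num.conj (w q t) * w q u)).
  apply: eq_bigr => t _; apply: eq_bigr => u _.
  rewrite (eq_bigr _ (fun i _ => (Pd i).2 (t i) (u i))) bigA_distr_bigA /=.
  rewrite mulr_sumr; apply: eq_bigr => q _.
  rewrite !big_split /= /w rmorphM rmorph_prod; ring.
under eq_bigr => t _ do rewrite exchange_big /=.
rewrite exchange_big /=; apply: eq_bigr => q _.
rewrite rmorph_sum mulr_suml mulr_sumr; apply: eq_bigr => t _.
by rewrite !mulr_sumr; apply: eq_bigr => u _.
Qed.

End HermitianForms.

(** * Generalized matrix functions on nonnegative integer combinations *)

Section GeneralizedMatrixFunction.
Variables (R : realType) (n : nat) (G : {group 'S_n}) (chi : 'S_n -> R[i]).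
Hypothesis chi_lin : is_linear_char G chi.

Lemma linear_char1 : chi 1%g = 1.
Proof.
have [rG ->//] := chi_lin.
by rewrite repr_mx1 mxtrace1.
Qed.

Lemma linear_charM : {in G &, {morph chi : s t / (s * t)%g >-> s * t}}.
Proof.
have [rG chiE] := chi_lin => s t sG tG.
by rewrite !chiE ?groupM // repr_mxM // /mxtrace !big_ord1 !mxE big_ord1.
Qed.

(** Since [s] has finite order, [chi s] is a root of unity and so has modulus 1. *)
Lemma linear_char_norm s : s \in G -> Num.conj (chi s) * chi s = 1.
Proof.
move=> sG; have chiX k : chi (s ^+ k)%g = chi s ^+ k.
  elim: k => [|k IH]; first by rewrite expg0 linear_char1.
  by rewrite expgS linear_charM ?groupX // IH exprS.
have : `|chi s| ^+ #[s]%g = 1 by rewrite -normrX -chiX expg_order linear_char1 normr1.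
move/eqP; rewrite pexpr_eq1 ?order_gt0 // => /eqP chi1.
by rewrite mulrC -normCK chi1 expr1n.
Qed.

(* The double sum, unlike the single one, stays nonnegative when the [n] copies
   of [A] are replaced by different positive semi-definite matrices. *)
Lemma gen_matrix_fun_polarized (A : 'M[R[i]]_n) :
  gen_matrix_fun G chi A *+ #|G| =
  \sum_(t in G) \sum_(u in G)
    Num.conj (chi t) * chi u * \prod_i A (t i) (u i).
Proof.
rewrite -sumr_const; apply: eq_bigr => t tG.
(* With [u = t * s] the factor [conj(chi t) chi(t)] cancels, and moving the row index along [t]
   makes every [t] contribute the same value. *)
rewrite [RHS](reindex_inj (mulgI t)) /=.
apply: eq_big => [s|s sG]; first by rewrite groupMl.
rewrite linear_charM // mulrA linear_char_norm // mul1r; congr (_ * _).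
by rewrite (reindex_inj (@perm_inj _ t)); apply: eq_bigr => i _; rewrite permM.
Qed.

Variables (m : nat) (A : 'I_m -> 'M[R[i]]_n).
Hypothesis A_psd : forall k, psdmx (A k).

Lemma diffs_ge0_gen_matrix_fun (s : seq {ffun 'I_m -> nat}) :
  diffs_ge0 s (fun v : {ffun 'I_m -> nat} =>
    complex.Re (gen_matrix_fun G chi (\sum_k A k *+ v k))).
Proof.
(* [D p] is [#|G|] times the averaged coefficient of the word [p], which places [A (p i)] in the
   [i]-th factor. *)
pose D (p : {ffun 'I_n -> 'I_m}) := \sum_(t in G) \sum_(u in G)
  Num.conj (chi t) * chi u * \prod_i A (p i) (t i) (u i).
have ReD_ge0 p : 0 <= complex.Re (D p).
  suff : 0 <= D p by case: (D p) => a b; rewrite lecE /= => /andP[].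
  apply: (@polarized_gmf_ge0 _ _ G chi (fun i => A (p i))) => i; by have [] := A_psd (p i).
have G0 : #|G|%:R != 0 :> R by rewrite pnatr_eq0 -lt0n cardG_gt0.
have expand v : gen_matrix_fun G chi (\sum_k A k *+ v k) *+ #|G| =
    \sum_p D p *+ \prod_i v (p i).
  rewrite gen_matrix_fun_polarized.
  under [RHS]eq_bigr => p _ do rewrite -mulr_natr mulr_suml.
  rewrite [RHS]exchange_big; apply: eq_bigr => t _.
  under [RHS]eq_bigr => p _ do rewrite mulr_suml.
  rewrite [RHS]exchange_big; apply: eq_bigr => u _.
  under [RHS]eq_bigr => p _ do rewrite -mulrA.
  rewrite -mulr_sumr; congr (_ * _).
  under eq_bigr => i _ do rewrite summxE.
  rewrite bigA_distr_bigA /=; apply: eq_bigr => p _.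
  rewrite natr_prod -big_split /=; apply: eq_bigr => i _.
  by rewrite mulmxnE mulr_natr.
(* Dividing by [#|G|] leaves a polynomial in the coordinates of [v] with nonnegative real
   coefficients. *)
apply: (@diffs_ge0_ext _ _ _ (fun v : {ffun 'I_m -> nat} => \sum_p
    (complex.Re (D p) / #|G|%:R) * \prod_i (v (p i))%:R)).
  move=> v; apply: (mulIf G0); rewrite [RHS]mulr_natr -raddfMn expand raddf_sum.
  rewrite mulr_suml; apply: eq_bigr => p _.
  by rewrite mulrAC divfK // raddfMn -mulr_natr natr_prod.
apply: diffs_ge0_sum => p; apply: diffs_ge0M.
  by apply: diffs_ge0_cst; rewrite divr_ge0.
by apply: diffs_ge0_prod => i; exact: diffs_ge0_eval.
Qed.

End GeneralizedMatrixFunction.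

(** * The alternating sum as a mixed difference along the unit vectors *)

Theorem theorem3p3 (R : realType) (m n : nat) (hm : (3 <= m)%N) (hn : (1 <= n)%N)
    (A : 'I_m -> 'M[R[i]]_n) (hA : forall k : 'I_m, psdmx (A k))
    (r : R)
    (hr : (exists k : nat, (1 <= k <= m - 2)%N /\ r = k%:R) \/
          (m - 1)%:R <= r)
    (G : {group 'S_n}) (chi : 'S_n -> R[i]) (hchi : is_linear_char G chi) :
  0 <= \sum_(1 <= j < m.+1)
         (-1) ^+ (m - j) *
         \sum_(J : {set 'I_m} | #|J| == j)
           powR (complex.Re (gen_matrix_fun G chi (\sum_(k in J) A k))) r.
Proof.
pose e k : {ffun 'I_m -> nat} := [ffun j => (j == k : nat)].
pose f (v : {ffun 'I_m -> nat}) :=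
  complex.Re (gen_matrix_fun G chi (\sum_k A k *+ v k)).
pose s := [seq e k | k <- enum 'I_m].
have f_ge0 : diffs_ge0 s f by exact: diffs_ge0_gen_matrix_fun.
(* Strict positivity gives [powR 0 r = 0], used below for the empty set. *)
have r_gt0 : 0 < r.
  case: hr => [[k [/andP[k1 _] ->]]|]; first by rewrite ltr0n.
  by apply: lt_le_trans; rewrite ltr0n; lia.
have fr_ge0 : diffs_ge0 s (fun v => powR (f v) r).
  case: hr => [[k [_ ->]]|mr].
    apply: diffs_ge0_ext (diffs_ge0X k f_ge0) => v.
    by rewrite powR_mulrn // (diffs_ge0_pointwise _ f_ge0).
  apply: diffs_ge0_powR => //; first exact: ltW.
  (* There are [m] differences, so the bound to check is [m <= r + 1]. *)
  rewrite size_map size_enum_ord; move: mr; rewrite natrB; [lra|lia].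
have := iter_fdiff_ge0 0 fr_ge0.
rewrite iter_fdiff_subsets ?enum_uniq // size_enum_ord.
set S := (X in 0 <= X -> _); set S' := (X in _ -> 0 <= X).
suff -> : S = S' by [].
have fE (J : {set 'I_m}) : f (0 + \sum_(k in J) e k) =
    complex.Re (gen_matrix_fun G chi (\sum_(k in J) A k)).
  rewrite add0r /f; congr (complex.Re (gen_matrix_fun _ _ _)).
  rewrite [RHS]big_mkcond; apply: eq_bigr => k _.
  rewrite sum_ffunE; under eq_bigr => j _ do rewrite ffunE.
  case: ifP => kJ.
    rewrite (bigD1 k) //= eqxx big1 ?addr0 // => j /andP[_ jk].
    by rewrite eq_sym (negbTE jk).
  rewrite big1 // => j jJ; case: eqP => // kj; by rewrite kj jJ in kJ.
have cardJ (J : {set 'I_m}) : (#|J| < m.+1)%N.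
  by rewrite ltnS -[m in (_ <= m)%N]card_ord max_card.
have inordE (J : {set 'I_m}) (j : 'I_m.+1) :
    (J \subset enum 'I_m) && (inord #|J| == j) = (#|J| == j).
  rewrite -val_eqE /= inordK //; case: subsetP => // -[].
  by move=> k _; rewrite mem_enum.
(* Subsets are grouped by cardinality, which ranges over [0..m], whereas the target sum starts at
   1. *)
rewrite /S /S' (partition_big (fun J : {set 'I_m} => inord #|J| : 'I_m.+1) predT) //=.
(* The class of cardinality 0 vanishes: as [n >= 1], each product in [d(0)] has a zero factor. *)
rewrite big_ord_recl /= big1 ?add0r; last first.
  move=> J; rewrite inordE cards_eq0 => /eqP ->.
  rewrite fE big_set0 /gen_matrix_fun big1 ?powR0 ?mulr0 ?gt_eqF // => t _.
  by rewrite (bigD1 (Ordinal hn)) //= mxE mul0r mulr0.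
rewrite big_add1 big_mkord; apply: eq_bigr => j _.
rewrite mulr_sumr; apply: eq_big => [J|J]; rewrite inordE //= => /eqP ->.
by rewrite fE.
Qed.
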